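(* Let $\mathsf{B}$ and $\mathsf{B}_n$ ($n\in\mathbb{N}$) be Banach spaces, let $\{T(t):t\ge 0\}$ and $\{T_n(t):t\ge 0\}$ be strongly continuous contraction semigroups on $\mathsf{B}$ and $\mathsf{B}_n$ with generators $\mathsf{L}$ and $\mathsf{L}_n$ and domains $\mathfrak{D}(\mathsf{L})$ and $\mathfrak{D}(\mathsf{L}_n)$, respectively. Let $\pi_n:\mathsf{B}\to\mathsf{B}_n$ be bounded linear operators, let $\Xi_n:\mathfrak{D}(\mathsf{L})\to\mathsf{B}_n$ be linear operators (not necessarily bounded), and put $\Phi_n=\pi_n+\Xi_n$. Assume: (H1) If $f\in\mathfrak{D}(\mathsf{L})$, then $\Phi_n f\in\mathfrak{D}(\mathsf{L}_n)$. (H2) There exist sequences $s_1(n)\searrow 0$, $s_2(n)\searrow 0$, $s_3(n)\searrow 0$ such that for all $f\in\mathfrak{D}(\mathsf{L}^2)$, $$\|\pi_n\mathsf{L}f-\mathsf{L}_n\Phi_n f\|\le s_1(n)\|f\|+s_2(n)\|\mathsf{L}f\|+s_3(n)\|\mathsf{L}^2f\|.$$ (H3) There exist sequences $r_1(n)\searrow 0$, $r_2(n)\searrow 0$ such that for all $f\in\mathfrak{D}(\mathsf{L})$, $$\|\Xi_n f\|\le r_1(n)\|f\|+r_2(n)\|\mathsf{L}f\|.$$ (H4) For each $f\in\mathfrak{D}(\mathsf{L}^2)$ (and each $t>0$, $n$), the function $s\in[0,t]\mapsto\Phi_nT(t-s)f\in\mathsf{B}_n$ is differentiable with derivative $-\Phi_n\mathsf{L}T(t-s)f$.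 Then for every $b>0$ there is a constant $C$ depending only on $b$ such that for all $f\in\mathfrak{D}(\mathsf{L}^2)$, all $t\in[0,b]$ and all $n$, $$\|T_n(t)\pi_nf-\pi_nT(t)f\|\le C\Big(\max\{s_1(n),r_1(n)\}\|f\|+\max\{s_2(n),r_1(n),r_2(n)\}\|\mathsf{L}f\|+\max\{s_3(n),r_2(n)\}\|\mathsf{L}^2f\|\Big).$$
   Context: All norms are denoted by $\|\cdot\|$. $f\in\mathfrak{D}(\mathsf{L}^2)$ means $f\in\mathfrak{D}(\mathsf{L})$ and $\mathsf{L}f\in\mathfrak{D}(\mathsf{L})$. The notation $a(n)\searrow 0$ means that $(a(n))$ is a sequence of non-negative numbers decreasing to zero. *)

(* Defs.v *)
From HB Require Import structures.
From mathcomp Require Import all_boot all_order all_algebra.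
From mathcomp Require Import all_classical all_reals all_analysis.

Set Implicit Arguments.
Unset Strict Implicit.
Unset Printing Implicit Defensive.

Import Order.TTheory GRing.Theory Num.Theory.
Import numFieldNormedType.Exports.

Local Open Scope classical_set_scope.
Local Open Scope ring_scope.

(* Scalars are real; a complex Banach space is covered by restriction of
   scalars, which changes neither norms nor derivatives in real time. *)

(* A semigroup is a family indexed by all of R, but only its members with
   index t >= 0 are constrained; the others are never used. *)
Record contraction_semigroup (R : realType) (B : completeNormedModType R)
    (T : R -> B -> B) : Prop := ContractionSemigroup {
  semigroup_linear : forall t, 0 <= t -> linear (T t) ;
  semigroup0 : forall f, T 0 f = f ;
  semigroupD : forall s t, 0 <= s -> 0 <= t ->
    forall f, T (s + t) f = T s (T t f) ;
  semigroup_contraction : forall t, 0 <= t -> forall f, `|T t f| <= `|f| ;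
  semigroup_strongly_continuous : forall f, T t f @[t --> 0^'+] --> f }.

Section Generator.
Variables (R : realType) (B : completeNormedModType R) (T : R -> B -> B).

Definition generator_quotient (f : B) (h : R) : B := h^-1 *: (T h f - f).

Definition generator_dom : set B :=
  [set f | cvg (generator_quotient f h @[h --> 0^'+])].

(* Only meaningful on generator_dom: lim is a default value elsewhere. *)
Definition generator (f : B) : B := lim (generator_quotient f h @[h --> 0^'+]).

Definition generator_dom2 : set B :=
  [set f | generator_dom f /\ generator_dom (generator f)].

End Generator.

(* Linearity of an operator with domain D, represented by a total function
   whose values outside D are irrelevant. *)
Definition linear_on (R : realType) (V W : normedModType R) (D : set V)
    (F : V -> W) : Prop :=
  forall (a : R) (f g : V), D f -> D g -> F (a *: f + g) = a *: F f + F g.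

(* F, as a function on A only, has derivative l at s; for A a closed interval
   this is the one-sided derivative at an endpoint. *)
Definition has_derivative_within (R : realType) (V : normedModType R)
    (A : set R) (F : R -> V) (s : R) (l : V) : Prop :=
  (u - s)^-1 *: (F u - F s) @[u --> within A (s^')] --> l.

Definition decreases_to0 (R : realType) (a : R^nat) : Prop :=
  [/\ forall n, 0 <= a n, nonincreasing_seq a & a @ \oo --> 0].

(* Main.v *)
Require Import Defs.
From HB Require Import structures.
From mathcomp Require Import all_boot all_order all_algebra.
From mathcomp Require Import all_classical all_reals all_analysis.
From mathcomp Require Import lra ring.

(** Duhamel's argument. For [f] in the domain of [L^2] and [t > 0], the curve
    [g s = Tn s (Phi (T (t - s) f))], [0 <= s <= t], joins [Phi (T t f)] to
    [Tn t (Phi f)]. Its formal derivative is [Tn s] applied to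
    [Ln (Phi h) - Phi (L h)] with [h = T (t - s) f], and this vector equals
    [(Ln (Phi h) - pi (L h)) - Xi (L h)], so (H2) at [h] and (H3) at [L h]
    bound it in terms of the norms of [h], [L h] and [L (L h)]. Since [L]
    commutes with the contraction [T (t - s)], these norms are at most those
    of [f], [L f] and [L (L f)]. A mean value inequality then bounds
    [Tn t (Phi f) - Phi (T t f)] by [t] times a constant, and (H3) at [f] and
    at [T t f] accounts for the passage from [Phi] to [pi]. Writing [M] for
    the expression that [C] multiplies in the conclusion, the derivative costs
    at most [2 * M] and each of the two terms in [Xi] at most [M], whence
    [C = 2 * b + 2].

    The curve [g] is never shown to be differentiable, and nothing is
    integrated. The contraction property gives
    [|Tn u x - Tn s y| <= |Tn (u - s) x - y|] for [s <= u], and this reduces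
    the increments of [g] near [s] to the derivative at [s] of
    [Phi (T (t - s) f)], given by (H4), and to the behaviour at [0^+] of the
    semigroup on two fixed vectors ([semigroup_increment]): they are at most
    [(K + e) * |u - s|], where [K] bounds the norm of the formal derivative.
    This local estimate is all that [mean_value_inequality] requires. *)

Set Implicit Arguments.
Unset Strict Implicit.
Unset Printing Implicit Defensive.

Import Order.TTheory GRing.Theory Num.Theory.
Import numFieldNormedType.Exports.

Local Open Scope classical_set_scope.
Local Open Scope ring_scope.

(** The hypothesis is a bound on local increments around each point, not a
    derivative, so that it applies to curves whose differentiability is unknown.
    For each slope [K + e], the points whose increment from [a] obeys the bound
    form a set [A] that contains its supremum (local bound to the left) and cannot
    stop before [b] (local bound to the right). *)
Lemma mean_value_inequality (R : realType) (V : normedModType R) (g : R -> V)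
    (a b K : R) : a <= b ->
  (forall s e, s \in `[a, b] -> 0 < e ->
    \forall u \near s, u \in `[a, b] -> `|g u - g s| <= (K + e) * `|u - s|) ->
  `|g b - g a| <= K * (b - a).
Proof.
move=> ab glip.
have [->|neq_ab] := eqVneq a b; first by rewrite !subrr normr0 mulr0.
have lt_ab : 0 < b - a by rewrite subr_gt0 lt_neqAle neq_ab.
apply/ler_addgt0Pr => e' e'0.
(* The slack [e'] allowed on the conclusion is spread evenly over [a, b]. *)
pose e := e' / (b - a).
have e0 : 0 < e by rewrite divr_gt0.
have -> : K * (b - a) + e' = (K + e) * (b - a).
  by rewrite mulrDl /e divfK ?gt_eqF.
pose A := [set u | u \in `[a, b] /\ `|g u - g a| <= (K + e) * (u - a)].
have Aa : A a by split; rewrite ?subrr ?normr0 ?mulr0// in_itv/= lexx.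
have supA : has_sup A.
  by split; [exists a | exists b => u []; rewrite in_itv/= => /andP[]].
have cab : sup A \in `[a, b].
  rewrite in_itv/= (ub_le_sup _ Aa)//=; last by case: supA.
  by apply: ge_sup; [exists a | move=> u []; rewrite in_itv/= => /andP[]].
have [d /= d0 gd] := (nbhs_ballP _ _).1 (glip _ _ cab e0).
have step (u v : R) : A u -> v \in `[a, b] -> u <= v ->
    `|g v - g u| <= (K + e) * (v - u) -> A v.
  move=> [uab gu] vab uv gvu; split=> //.
  rewrite -(subrKA (g u)) (le_trans (ler_normD _ _))//.
  by rewrite -(subrKA u v) mulrDr lerD.
have Ac : A (sup A).
  have [u Au cu] := sup_adherent d0 supA.
  have uc : u <= sup A by apply: ub_le_sup => //; case: supA.
  apply: (step u) => //.
  have ucd : ball (sup A) d u by rewrite /ball/= ger0_norm ?subr_ge0//; lra.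
  have := gd u ucd (proj1 Au).
  by rewrite distrC (distrC u) (ger0_norm (x := sup A - u)) ?subr_ge0.
have [cb|bc] := ltP (sup A) b; last first.
  have -> : b = sup A by apply/le_anti; rewrite bc; case/itvP: cab => ->.
  by case: Ac.
pose v := Num.min b (sup A + d / 2).
have cv : sup A < v by rewrite lt_min cb/= ltrDl divr_gt0.
have vd : v - sup A < d.
  have : v <= sup A + d / 2 by rewrite ge_min lexx orbT.
  by lra.
have vab : v \in `[a, b].
  rewrite in_itv/= ge_min lexx/= andbT (le_trans _ (ltW cv))//.
  by move: cab; rewrite in_itv/= => /andP[].
suff Av : A v by have := ub_le_sup (proj2 supA) Av; rewrite leNgt cv.
apply: (step (sup A)) => //; first exact: ltW.
have vc0 : 0 <= v - sup A by rewrite subr_ge0 ltW.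
have vcd : ball (sup A) d v by rewrite /ball/= distrC ger0_norm.
by have := gd v vcd vab; rewrite (ger0_norm vc0).
Qed.

Section ContractionSemigroup.
Variables (R : realType) (V : completeNormedModType R) (S : R -> V -> V).
Hypothesis csS : contraction_semigroup S.

Lemma semigroupB t f g : 0 <= t -> S t (f - g) = S t f - S t g.
Proof.
move=> t0; have := semigroup_linear csS t0 (-1) g f.
by rewrite !scaleN1r ![- _ + _]addrC.
Qed.

Lemma semigroupZ t a f : 0 <= t -> S t (a *: f) = a *: S t f.
Proof.
move=> t0; have S0 : S t 0 = 0 by have := @semigroupB t 0 0 t0; rewrite !subrr.
by have := semigroup_linear csS t0 a f 0; rewrite S0 !addr0.
Qed.

Lemma semigroup_continuous t : 0 <= t -> continuous (S t).
Proof.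
move=> t0 f; apply/cvgrPdist_lt => e e0; near=> g.
rewrite -semigroupB//; apply: le_lt_trans (semigroup_contraction csS t0 _) _.
by near: g; exact: cvgr_dist_lt.
Unshelve. all: end_near. Qed.

(** [S t] commutes with the difference quotients at [f], and is continuous.
    The invariance of the domain and the commutation of the generator with
    [S t] both follow. *)
Lemma generator_quotient_semigroup t f : 0 <= t -> generator_dom S f ->
  generator_quotient S (S t f) h @[h --> 0^'+] --> S t (generator S f).
Proof.
move=> t0 domf.
have : S t (generator_quotient S f h) @[h --> 0^'+] --> S t (generator S f).
  by apply: continuous_cvg; [exact: semigroup_continuous | exact: domf].
apply: cvg_trans; apply: near_eq_cvg; near=> h.
have h0 : 0 <= h by [].
rewrite /generator_quotient semigroupZ// semigroupB//.
by rewrite -!(semigroupD csS)// (addrC t).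
Unshelve. all: end_near. Qed.

Lemma generator_dom_semigroup t f : 0 <= t -> generator_dom S f ->
  generator_dom S (S t f).
Proof. by move=> t0 domf; apply/cvg_ex; exists (S t (generator S f));
  exact: generator_quotient_semigroup. Qed.

Lemma generator_semigroup t f : 0 <= t -> generator_dom S f ->
  generator S (S t f) = S t (generator S f).
Proof.
move=> t0 domf; apply: cvg_lim => //.
exact: generator_quotient_semigroup.
Qed.

Lemma generator_dom2_semigroup t f : 0 <= t -> generator_dom2 S f ->
  generator_dom2 S (S t f).
Proof.
move=> t0 [domf domLf]; split; first exact: generator_dom_semigroup.
by rewrite generator_semigroup//; exact: generator_dom_semigroup.
Qed.

(** Factoring out [S s], a contraction, turns a comparison at times [s] and [u]
    into one at times [0] and [u - s]. *)
Lemma semigroup_dist_le s u f g : 0 <= s -> s <= u ->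
  `|S u f - S s g| <= `|S (u - s) f - g|.
Proof.
move=> s0 su; have us0 : 0 <= u - s by rewrite subr_ge0.
rewrite -[in S u](subrKC s u) (semigroupD csS s0 us0) -semigroupB//.
exact: semigroup_contraction.
Qed.

(** One half of the product rule for [u |-> S u (F u)], whose derivative at [s]
    would be [S s (generator S (F s) + l)]: only the norm of an increment is
    estimated. With [h = |u - s|], [q] the difference quotient of the
    semigroup at [F s] and [D] that of [F], the increment is at most
    [h * |q + D|] if [u < s] and [h * |q + S h D|] if [s <= u]. The errors
    [generator S (F s) - q], [l - D] and [l - S h l] are each below [e / 3] for
    [u] close to [s]. *)
Lemma semigroup_increment (F : R -> V) (t s K e : R) (l : V) :
    s \in `[0, t] -> generator_dom S (F s) ->
    has_derivative_within [set` `[0, t]] F s l ->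
    `|generator S (F s) + l| <= K -> 0 < e ->
  \forall u \near s, u \in `[0, t] ->
    `|S u (F u) - S s (F s)| <= (K + e) * `|u - s|.
Proof.
move=> st domFs Fs_l leK e0.
have e3 : 0 < e / 3 by rewrite divr_gt0.
have s0 : 0 <= s by case/itvP: st => ->.
have /cvgrPdist_lt/(_ _ e3) : S h l @[h --> 0^'+] --> l.
  exact: semigroup_strongly_continuous.
move=> /(nbhs_ballP _ _).1 [d1 /= d10 Sl].
have /cvgrPdist_lt/(_ _ e3) :
  generator_quotient S (F s) h @[h --> 0^'+] --> generator S (F s) by [].
move=> /(nbhs_ballP _ _).1 [d2 /= d20 Sq].
move: Fs_l => /cvgrPdist_lt/(_ _ e3)/(nbhs_ballP _ _).1 [d3 /= d30 DF].
near=> u => ut.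
have u0 : 0 <= u by case/itvP: ut => ->.
have [->|us] := eqVneq u s; first by rewrite !subrr !normr0 mulr0.
have d1u : `|s - u| < d1 by near: u; exact: cvgr_dist_lt.
have d2u : `|s - u| < d2 by near: u; exact: cvgr_dist_lt.
have d3u : `|s - u| < d3 by near: u; exact: cvgr_dist_lt.
have h_gt0 : 0 < `|u - s| by rewrite normr_gt0 subr_eq0.
have hb d : `|s - u| < d -> ball (0 : R) d `|u - s|.
  by rewrite /ball/= sub0r normrN normr_id distrC.
move: (Sl _ (hb _ d1u) h_gt0) (Sq _ (hb _ d2u) h_gt0) (DF _ d3u us ut).
move: (generator S (F s)) leK => G leK.
have h_ge0 := ltW h_gt0.
set h := `|u - s|; set q := generator_quotient _ _ _; set D := _ *: _.
move=> Slh Sqh DFu.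
have hq : h *: q = S h (F s) - F s.
  by rewrite /q /generator_quotient scalerA divff ?gt_eqF// scale1r.
have hD : (u - s) *: D = F u - F s.
  by rewrite /D scalerA divff ?subr_eq0// scale1r.
have near_sum (x y : V) : `|x + y| <= K + `|G - x| + `|l - y|.
  have -> : x + y = (G + l) - (G - x + (l - y)).
    by rewrite addrACA -opprD subKr.
  rewrite -[leRHS]addrA (le_trans (ler_normB _ _))// lerD//.
  exact: ler_normD.
have [lt_us|le_su] := ltP u s.
  have hE : h = s - u by rewrite /h distrC ger0_norm// subr_ge0 ltW.
  rewrite distrC (le_trans (semigroup_dist_le _ _ u0 (ltW lt_us)))//.
  have -> : S (s - u) (F s) - F u = h *: (q + D).
    rewrite scalerDr hq.
    have -> : h *: D = F s - F u by rewrite -opprB -hD -scaleNr opprB hE.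
    by rewrite -hE addrA subrK.
  rewrite normrZ normr_id mulrC ler_wpM2r//.
  by have := near_sum q D; lra.
have hE : h = u - s by rewrite /h ger0_norm// subr_ge0.
rewrite (le_trans (semigroup_dist_le _ _ s0 le_su))//.
have -> : S (u - s) (F u) - F s = h *: (q + S h D).
  have {}hD : h *: D = F u - F s by rewrite hE.
  rewrite scalerDr hq -semigroupZ// hD semigroupB// -hE.
  by rewrite [RHS]addrC subrKA.
rewrite normrZ normr_id mulrC ler_wpM2r//.
(* [S h] is applied to the varying vector [D]; contractivity replaces it by
   its limit [l], where strong continuity applies. *)
have : `|l - S h D| <= `|l - S h l| + `|l - D|.
  rewrite -(subrKA (S h l)) (le_trans (ler_normD _ _))// lerD2l.
  by rewrite -semigroupB// semigroup_contraction.
by have := near_sum q (S h D); lra.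
Unshelve. all: end_near. Qed.

End ContractionSemigroup.

Theorem theorem2p2 (R : realType) (b : R) (b_gt0 : 0 < b) :
  exists C : R,
  forall (B : completeNormedModType R) (Bn : nat -> completeNormedModType R)
    (T : R -> B -> B) (Tn : forall n, R -> Bn n -> Bn n)
    (pi_ : forall n, {linear B -> Bn n}) (Xi : forall n, B -> Bn n)
    (s1 s2 s3 r1 r2 : R^nat),
  let L := generator T in
  let Ln n := generator (Tn n) in
  let Phi n f := pi_ n f + Xi n f in
  contraction_semigroup T ->
  (forall n, contraction_semigroup (Tn n)) ->
  (forall n, bounded_near (pi_ n) (nbhs (0 : B))) ->
  (forall n, linear_on (generator_dom T) (Xi n)) ->
  (* H1 *)
  (forall n f, generator_dom T f -> generator_dom (Tn n) (Phi n f)) ->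
  (* H2 *)
  decreases_to0 s1 -> decreases_to0 s2 -> decreases_to0 s3 ->
  (forall n f, generator_dom2 T f ->
    `|pi_ n (L f) - Ln n (Phi n f)|
      <= s1 n * `|f| + s2 n * `|L f| + s3 n * `|L (L f)|) ->
  (* H3 *)
  decreases_to0 r1 -> decreases_to0 r2 ->
  (forall n f, generator_dom T f ->
    `|Xi n f| <= r1 n * `|f| + r2 n * `|L f|) ->
  (* H4 *)
  (forall n f t, generator_dom2 T f -> 0 < t ->
    forall s, s \in `[0, t] ->
      has_derivative_within [set` `[0, t]] (fun u => Phi n (T (t - u) f)) s
        (- Phi n (L (T (t - s) f)))) ->
  forall f t n, generator_dom2 T f -> t \in `[0, b] ->
    `|Tn n t (pi_ n f) - pi_ n (T t f)|
      <= C * (Num.max (s1 n) (r1 n) * `|f|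
              + Num.max (s2 n) (Num.max (r1 n) (r2 n)) * `|L f|
              + Num.max (s3 n) (r2 n) * `|L (L f)|).
Proof.
exists (2 * b + 2) => B Bn T Tn pi_ Xi s1 s2 s3 r1 r2 L Ln Phi csT csTn _ _ H1.
move=> [s1ge0 _ _] [s2ge0 _ _] [s3ge0 _ _] H2 [r1ge0 _ _] [r2ge0 _ _] H3 H4.
move=> f t n dom2f tb.
have /andP[t0 tleb] : (0 <= t) && (t <= b) by move: tb; rewrite in_itv.
set m1 := Num.max (s1 n) (r1 n); set m2 := Num.max (s2 n) _.
set m3 := Num.max (s3 n) (r2 n).
set M := m1 * `|f| + m2 * `|L f| + m3 * `|L (L f)|.
have [[m1s m1r] [m2s m2r1 m2r2] [m3s m3r]] :
    [/\ s1 n <= m1 /\ r1 n <= m1, [/\ s2 n <= m2, r1 n <= m2 & r2 n <= m2]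
      & s3 n <= m3 /\ r2 n <= m3].
  by rewrite /m1 /m2 /m3 !le_max !lexx !orbT.
have m3ge0 : 0 <= m3 by exact: le_trans (s3ge0 n) m3s.
(* [leXi] and [leK] are stated for any [g] dominated by [f], because they serve
   both at [f] and at the points of its orbit. *)
have leXi g : generator_dom T g -> `|g| <= `|f| -> `|L g| <= `|L f| ->
    `|Xi n g| <= M.
  move=> domg gf Lgf; rewrite (le_trans (H3 n g domg))//.
  rewrite (@le_trans _ _ (m1 * `|f| + m2 * `|L f|))//.
    by rewrite lerD// ler_pM.
  by rewrite lerDl mulr_ge0.
have leK g : generator_dom2 T g -> `|g| <= `|f| -> `|L g| <= `|L f| ->
    `|L (L g)| <= `|L (L f)| -> `|Ln n (Phi n g) - Phi n (L g)| <= 2 * M.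
  move=> dom2g gf Lgf LLgf.
  rewrite opprD addrA (le_trans (ler_normB _ _))// mulr_natl mulr2n lerD//.
    rewrite distrC (le_trans (H2 n g dom2g))//.
    by rewrite !lerD// ler_pM.
  rewrite (le_trans (H3 n _ (proj2 dom2g)))//.
  rewrite (@le_trans _ _ (m2 * `|L f| + m3 * `|L (L f)|))//.
    by rewrite lerD// ler_pM.
  by rewrite /M -addrA lerDr mulr_ge0// (le_trans (s1ge0 n)).
have evolution : `|Tn n t (Phi n f) - Phi n (T t f)| <= 2 * M * t.
  have [->|t_neq0] := eqVneq t 0.
    by rewrite !semigroup0// subrr normr0 mulr0.
  have t_gt0 : 0 < t by rewrite lt_neqAle eq_sym t_neq0.
  pose g s := Tn n s (Phi n (T (t - s) f)).
  have -> : Tn n t (Phi n f) - Phi n (T t f) = g t - g 0.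
    by rewrite /g subrr subr0 !semigroup0.
  rewrite -[t in _ * t]subr0; apply: mean_value_inequality => // s e st e0.
  have ts0 : 0 <= t - s by rewrite subr_ge0; case/itvP: st => ->.
  have dom2Tf : generator_dom2 T (T (t - s) f).
    exact: generator_dom2_semigroup.
  have [domf domLf] := dom2f.
  have LT : L (T (t - s) f) = T (t - s) (L f) by exact: generator_semigroup.
  have LLT : L (L (T (t - s) f)) = T (t - s) (L (L f)).
    by rewrite LT; exact: generator_semigroup.
  apply: semigroup_increment (H4 n f t dom2f t_gt0 s st) _ e0 => //.
    exact: H1 (proj1 dom2Tf).
  by apply: leK => //; rewrite ?LLT ?LT; exact: semigroup_contraction.
have -> : Tn n t (pi_ n f) - pi_ n (T t f) =
    (Tn n t (Phi n f) - Phi n (T t f)) - (Tn n t (Xi n f) - Xi n (T t f)).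
  have -> : Tn n t (pi_ n f) = Tn n t (Phi n f) - Tn n t (Xi n f).
    by rewrite -(semigroupB (csTn n))// addrK.
  by rewrite /Phi opprB opprD (addrA _ (- pi_ n _)) subrKA addrAC.
have [domf _] := dom2f.
have Xi_f : `|Tn n t (Xi n f)| <= M.
  by rewrite (le_trans (semigroup_contraction (csTn n) t0 _))// leXi.
have Xi_Tf : `|Xi n (T t f)| <= M.
  apply: leXi; first exact: generator_dom_semigroup.
    exact: semigroup_contraction.
  rewrite /L generator_semigroup//; exact: semigroup_contraction.
have M0 : 0 <= M by exact: le_trans (normr_ge0 _) Xi_f.
have Mt : 2 * M * t <= 2 * M * b by rewrite ler_wpM2l// mulr_ge0.
rewrite (_ : (2 * b + 2) * M = 2 * M * b + 2 * M); last by ring.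
have := ler_normB (Tn n t (Phi n f) - Phi n (T t f))
  (Tn n t (Xi n f) - Xi n (T t f)).
have := ler_normB (Tn n t (Xi n f)) (Xi n (T t f)).
by lra.
Qed.
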